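(* Let $d\ge 2$ and let $p=(p_1,\dots,p_d)$ be a probability vector with $p_j\neq 1$ for all $j$. Let $l_n$ be the SICTA collision resolution interval lengths and $t_{2,m}$ the resolution delay of a tagged packet in the presence of $m$ other packets, both with splitting probabilities $p$. Put $$G_{m+1}(z)=\mathbb{E}\big[z^{t_{2,m}}\big],\qquad G(x,z)=\sum_{m\ge 0}G_{m+1}(z)e^{-x}\frac{x^m}{m!},\qquad Q(x,z)=e^{-x}\sum_{n\ge 0}\frac{x^n}{n!}\mathbb{E}\big[z^{l_n}\big].$$ Then (for all $x,z\in\mathbb{C}$ for which the expectations and series converge absolutely, in particular for $|z|\le 1$) $$G(x,z)=\sum_{k=1}^d p_k\left(e^{-x}\big(z-z^{k+\mathbf{1}\{k<d\}}\big)+z^{\mathbf{1}\{k<d\}}\,G(p_kx,z)\prod_{i=1}^{k-1}Q(p_ix,z)\right).$$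
   Context: Definition of $l_n$. For $n\ge 2$ let $(I_1,\dots,I_d)$ be multinomially distributed with $n$ trials and cell probabilities $p$, and let $M=\inf\{k\in\{1,\dots,d\}: \sum_{j=1}^k I_j\ge n-1\}$. The laws of the (almost surely finite, positive integer valued) random variables $l_n$ are determined recursively by $l_0=l_1=1$ and, for $n\ge 2$, $l_n=\mathbf{1}\{M<d\}+\sum_{j=1}^{M} l_{I_j}$ in distribution, where, given $(I_1,\dots,I_d)$, the variables $l_{I_1},\dots,l_{I_d}$ on the right are independent, $l_{I_j}$ having the law of $l_m$ with $m=I_j$. Definition of $t_{2,m}$. Let $g\in\{1,\dots,d\}$ be the group joined by the tagged packet, $\mathbb{P}(g=k)=p_k$, and independently let $(I_1,\dots,I_d)$ be multinomial with $m$ trials and cell probabilities $p$ (the numbers of the other $m$ packets joining each group). The laws of the (almost surely finite) variables $t_{2,m}$ are determined by $t_{2,0}=1$ and, for $m\ge1$, in distribution, $$t_{2,m}=\mathbf{1}\{g<d\}+\sum_{j=1}^{g-1}l_{I_j}+t_{2,I_g},$$ where, given $g$ and $(I_1,\dots,I_d)$, the variables $l_{I_1},\dots,l_{I_{g-1}},t_{2,I_g}$ on the right are independent with the corresponding laws. The empty product equals $1$. *)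

(* Defs.v *)
From HB Require Import structures.
From mathcomp Require Import all_boot all_order all_algebra.
From mathcomp Require Import all_classical all_reals all_analysis.
From mathcomp.real_closed Require Export complex.

Set Implicit Arguments.
Unset Strict Implicit.
Unset Printing Implicit Defensive.

Import Order.TTheory GRing.Theory Num.Theory.
Import numFieldNormedType.Exports.

Local Open Scope classical_set_scope.
Local Open Scope ring_scope.
Local Open Scope complex_scope.

(* [R[i]] carries no topology of its own; seen as a [numFieldType] it inherits
   the one of its norm. *)
Definition Cfield (R : realType) : numFieldType := R[i].

Definition RtoC (R : realType) (r : R) : Cfield R := r%:C.

Definition Cseries (R : realType) (u : nat -> Cfield R) : Cfield R :=
  limn (series u).

Definition Cabs (R : realType) (z : Cfield R) : R := complex.Re `|z|.

Definition Cabs_summable (R : realType) (u : nat -> Cfield R) : Prop :=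
  cvgn (series (fun n => Cabs (u n))).

Definition Cexp (R : realType) (z : Cfield R) : Cfield R :=
  Cseries (fun n => z ^+ n / n`!%:R).

Section Expectation.
Context d (T : measurableType d) (R : realType) (P : probability T R).

Definition Cexpectation (f : T -> Cfield R) : Cfield R :=
  fine 'E_P[fun w => complex.Re (f w)] +i* fine 'E_P[fun w => complex.Im (f w)].

(* The expectation of [f] converges absolutely; meant for measurable [f]. *)
Definition Cabs_integrable (f : T -> Cfield R) : Prop :=
  ('E_P[fun w => Cabs (f w)] < +oo)%E.

End Expectation.

(* Cells are numbered from 0 to [d.-1]: the cell [j : 'I_d] is the
   [j.+1]-st one. *)

Definition multinomial_pmf (R : realType) (d : nat) (p : 'I_d -> R) (n : nat)
    (i : 'I_d -> nat) : R :=
  if (\sum_j i j == n)%N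
  then n`!%:R / (\prod_j (i j)`!%:R) * \prod_j p j ^+ i j
  else 0.

Definition is_multinomial (dT : measure_display) (T : measurableType dT)
    (R : realType) (P : probability T R) (d : nat) (p : 'I_d -> R) (n : nat)
    (I : 'I_d -> {RV P >-> nat}) : Prop :=
  forall i : 'I_d -> nat,
    P [set w | forall j, I j w = i j] = (multinomial_pmf p n i)%:E.

(* The least [k] in [1, d] such that the first [k] cells contain at least
   [n - 1] packets; it exists when the [i j] sum to [n]. *)
Definition stop_cell (d n : nat) (i : 'I_d -> nat) : nat :=
  head d [seq k <- iota 1 d | n.-1 <= \sum_(j < d | j < k) i j]%N.

(* The recursive distributional equations speak about auxiliary variables,
   realized here on some probability space [Q]: [X j], [j < M], plays the part
   of [l_{I_j}] and [Y] the part of [t_{2,I_g}]. Their conditional independence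
   and conditional laws are given by their joint mass function. *)

Definition cri_equation (dT : measure_display) (T : measurableType dT)
    (R : realType) (P : probability T R) (d : nat) (p : 'I_d -> R)
    (l : nat -> {RV P >-> nat}) (n : nat) : Prop :=
  exists (dS : measure_display) (S : measurableType dS) (Q : probability S R)
         (I X : 'I_d -> {RV Q >-> nat}),
  let M w := stop_cell n (fun j => I j w) in
  [/\ is_multinomial p n I,
      forall i x : 'I_d -> nat,
        (Q [set w | (forall j, I j w = i j) /\
                    (forall j : 'I_d, (j < stop_cell n i)%N -> X j w = x j)] =
         Q [set w | forall j, I j w = i j] *
         (\prod_(j < d | (j < stop_cell n i)%N)
             fine (P [set w | l (i j) w = x j]))%:E)%E
    & forall A : set nat,
        P (l n @^-1` A) =
        Q [set w | A ((M w < d) + \sum_(j < d | j < M w) X j w)%N] ].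

Definition is_cri_length (dT : measure_display) (T : measurableType dT)
    (R : realType) (P : probability T R) (d : nat) (p : 'I_d -> R)
    (l : nat -> {RV P >-> nat}) : Prop :=
  [/\ P (l 0 @^-1` [set 1%N]) = 1%E,
      P (l 1 @^-1` [set 1%N]) = 1%E
    & forall n, (2 <= n)%N -> cri_equation p l n].

Definition delay_equation (dT : measure_display) (T : measurableType dT)
    (R : realType) (P : probability T R) (d : nat) (p : 'I_d -> R)
    (l t : nat -> {RV P >-> nat}) (m : nat) : Prop :=
  exists (dS : measure_display) (S : measurableType dS) (Q : probability S R)
         (g : S -> 'I_d) (I X : 'I_d -> {RV Q >-> nat}) (Y : {RV Q >-> nat}),
  [/\ forall k, measurable (g @^-1` [set k]) /\ Q (g @^-1` [set k]) = (p k)%:E,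
      is_multinomial p m I,
      forall (k : 'I_d) (i : 'I_d -> nat),
        (Q [set w | g w = k /\ (forall j, I j w = i j)] =
         Q (g @^-1` [set k]) * Q [set w | forall j, I j w = i j])%E,
      forall (k : 'I_d) (i x : 'I_d -> nat) (y : nat),
        (Q [set w | [/\ g w = k, forall j, I j w = i j,
                        forall j : 'I_d, (j < k)%N -> X j w = x j & Y w = y]] =
         Q [set w | g w = k /\ (forall j, I j w = i j)] *
         (\prod_(j < d | (j < k)%N) fine (P [set w | l (i j) w = x j]) *
          fine (P [set w | t (i k) w = y]))%:E)%E
    & forall A : set nat,
        P (t m @^-1` A) =
        Q [set w | A (((g w).+1 < d) + \sum_(j < d | j < g w) X j w + Y w)%N] ].

(* [t m] is the delay of a tagged packet in the presence of [m] others. *)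
Definition is_tagged_delay (dT : measure_display) (T : measurableType dT)
    (R : realType) (P : probability T R) (d : nat) (p : 'I_d -> R)
    (l t : nat -> {RV P >-> nat}) : Prop :=
  P (t 0 @^-1` [set 1%N]) = 1%E /\
  forall m, (1 <= m)%N -> delay_equation p l t m.

Section GeneratingFunctions.
Context (dT : measure_display) (T : measurableType dT) (R : realType)
        (P : probability T R).

(* [pgf t m] is G_{m+1} when [t m] is the delay among [m] other packets. *)
Definition pgf (X : nat -> {RV P >-> nat}) (n : nat) (z : Cfield R) : Cfield R :=
  Cexpectation P (fun w => z ^+ X n w).

Definition pgf_converges (X : nat -> {RV P >-> nat}) (z : Cfield R) : Prop :=
  forall n, Cabs_integrable P (fun w => z ^+ X n w).

Definition Gterm (t : nat -> {RV P >-> nat}) (x z : Cfield R) (m : nat) :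
    Cfield R :=
  pgf t m z * Cexp (- x) * (x ^+ m / m`!%:R).

Definition Gfun (t : nat -> {RV P >-> nat}) (x z : Cfield R) : Cfield R :=
  Cseries (Gterm t x z).

Definition Qterm (l : nat -> {RV P >-> nat}) (x z : Cfield R) (n : nat) :
    Cfield R :=
  x ^+ n / n`!%:R * pgf l n z.

Definition Qfun (l : nat -> {RV P >-> nat}) (x z : Cfield R) : Cfield R :=
  Cexp (- x) * Cseries (Qterm l x z).

(* Absolute convergence of every expectation and every series that enters the
   functional equation of G at (x, z). *)
Definition converges_at (d : nat) (p : 'I_d -> R)
    (l t : nat -> {RV P >-> nat}) (x z : Cfield R) : Prop :=
  [/\ pgf_converges l z,
      pgf_converges t z,
      Cabs_summable (Gterm t x z),
      forall k : 'I_d, Cabs_summable (Gterm t (RtoC (p k) * x) z)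
    & forall k i : 'I_d, (i < k)%N -> Cabs_summable (Qterm l (RtoC (p i) * x) z)].

End GeneratingFunctions.

(* Main.v *)
From HB Require Import structures.
Require Import Defs.
From mathcomp Require Import all_boot all_order all_algebra.
From mathcomp Require Import all_classical all_reals all_analysis.
From mathcomp Require Import measurable_realfun ring.

Import Order.TTheory GRing.Theory Num.Theory.
Import numFieldNormedType.Exports.
Local Open Scope classical_set_scope.
Local Open Scope ring_scope.
Local Open Scope complex_scope.

Set Implicit Arguments.
Unset Strict Implicit.
Unset Printing Implicit Defensive.

(** Multiplied by [x ^+ m / m`!], a multinomial average over the sizes of the
    [d] groups becomes a coefficient of a product of [d] power series: the
    multinomial probability is [m`! * \prod_j p j ^+ i j / (i j)`!], so
    [x ^+ m / m`! * E(\prod_j f j (I j))] is the sum, over the [i] with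
    [\sum_j i j = m], of [\prod_j ((p j * x) ^+ i j / (i j)`! * f j (i j))].
    Summing over [m] therefore turns the recursion for [t] into a product of
    [d] Poisson transforms. Given that the tagged packet joins group [k], the
    factor of a group [j < k] is the Poisson transform [Qfun l] at [p j * x],
    that of group [k] is [Gfun t] at [p k * x], and a group [j > k], which
    does not delay the packet, contributes the exponential series, cancelled
    by its share of [Cexp (- x) = \prod_j Cexp (- (p j * x))]. The recursion
    holds for [m >= 1] only. For [m = 0] its right-hand side would be
    [z ^+ (k.+1 + (k.+1 < d))] when group [k] is joined, each of the [k]
    groups before it and the packet itself taking one slot, while [t 0 = 1]
    has generating function [z]; the difference is the term
    [Cexp (- x) * (z - z ^+ (k.+1 + (k.+1 < d)))] of the equation.

    Both passages from independence to products of generating functions rest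
    on the Cauchy product of finitely many absolutely convergent series,
    [cvg_cauchy_coef]. It is used a first time in the variable [z]. By the
    distributional equation, [t m = n] has the probability of an event that
    is, up to a null set, a finite disjoint union of events that fix the group
    joined, the group sizes and the summands of the delay; hence [mass (t m) n] is a finite combination of Cauchy coefficients of
    mass functions ([delay_mass]), and summation against [z ^+ n] gives the
    recursion for the generating functions, [pgf_delay]. It is used a second
    time in the variable [x], where [Gterm_split] writes the terms of [Gfun]
    as Cauchy coefficients and [Gfun_equation] sums them. This route needs
    absolute convergence at the given point only, hence also reaches the
    points with [1 < `|z|].

    For [`|z| <= 1] all generating functions are bounded, and every series is
    dominated by an exponential series ([converges_at_le1]). *)

(** * Cauchy products of finitely many series *)

(** The [n]-th coefficient of the product of the formal series [a j]. An index
    in a multi-index of sum [n] is at most [n], which makes the multi-indices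
    a finite type. *)
Definition cauchy_coef (K : pzSemiRingType) (J : finType) (a : J -> nat -> K) (n : nat) : K :=
  \sum_(x : {ffun J -> 'I_n.+1} | (\sum_j x j == n)%N) \prod_j a j (x j).

(** Multi-indices bounded by [n] and by [N] have different types; this lemma
    and the next one transport sums between the two through the common type of
    functions to [nat]. *)
Lemma big_ffun_widen (V : nmodType) (J : finType) (q : pred {ffun J -> nat})
    (F : {ffun J -> nat} -> V) (n N : nat) : (n <= N)%N ->
  (forall x, q x -> forall j, (x j < n)%N) ->
  \sum_(x : {ffun J -> 'I_n} | q [ffun j => nat_of_ord (x j)])
     F [ffun j => nat_of_ord (x j)] =
  \sum_(x : {ffun J -> 'I_N} | q [ffun j => nat_of_ord (x j)])
     F [ffun j => nat_of_ord (x j)].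
Proof.
move=> nN qn.
pose h (x : {ffun J -> 'I_n}) : {ffun J -> 'I_N} := [ffun j => widen_ord nN (x j)].
have hE x : [ffun j => nat_of_ord (h x j)] = [ffun j => nat_of_ord (x j)].
  by apply/ffunP => j; rewrite !ffunE.
case: (pickP (fun _ : J => true)) => [j0 _|J0]; last first.
  pose g (x : {ffun J -> 'I_N}) : {ffun J -> 'I_n} := ffun0 (eq_card0 J0).
  rewrite [RHS](reindex_onto h g) /=; last first.
    by move=> x _; apply/ffunP => j; have := J0 j.
  apply: eq_big => [x|x _]; last by rewrite hE.
  by rewrite hE; case: eqP => [_|[]]; [rewrite andbT|apply/ffunP => j; have := J0 j].
case: n => [|n] in nN qn h hE *.
  rewrite big_pred0 ?big_pred0// => x; apply/negP => /qn /(_ j0).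
  - by rewrite ltn0.
  - by rewrite ltn0.
pose g (x : {ffun J -> 'I_N}) : {ffun J -> 'I_n.+1} := [ffun j => inord (x j)].
rewrite [RHS](reindex_onto h g) /=; last first.
  move=> x qx; apply/ffunP => j; apply/val_inj; rewrite !ffunE /= inordK//.
  by have := qn _ qx j; rewrite ffunE.
apply: eq_big => [x|x _]; last by rewrite hE.
rewrite hE; case: eqP => [_|[]]; first by rewrite andbT.
by apply/ffunP => j; apply/val_inj; rewrite !ffunE /= inordK.
Qed.

Lemma big_ffunE (V : nmodType) (J : finType) (N : nat) (q : {ffun J -> nat} -> bool)
    (F : {ffun J -> nat} -> V) (q' : pred {ffun J -> 'I_N}) F' :
  (forall x : {ffun J -> 'I_N}, q' x = q [ffun j => nat_of_ord (x j)]) ->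
  (forall x : {ffun J -> 'I_N}, F' x = F [ffun j => nat_of_ord (x j)]) ->
  \sum_(x : {ffun J -> 'I_N} | q' x) F' x =
  \sum_(x : {ffun J -> 'I_N} | q [ffun j => nat_of_ord (x j)])
     F [ffun j => nat_of_ord (x j)].
Proof. by move=> hq hF; apply: eq_big => // x _. Qed.

Lemma cauchy_coef_widen (K : pzSemiRingType) (J : finType) (a : J -> nat -> K)
    (n N : nat) : (n < N)%N ->
  cauchy_coef a n = \sum_(x : {ffun J -> 'I_N} | (\sum_j x j == n)%N) \prod_j a j (x j).
Proof.
move=> nN; rewrite /cauchy_coef.
pose q (x : {ffun J -> nat}) := (\sum_j x j == n)%N.
pose F (x : {ffun J -> nat}) := \prod_j a j (x j).
rewrite (big_ffunE (q := q) (F := F)); last 2 first.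
- by move=> x; rewrite /q; congr (_ == _); apply: eq_bigr => j _; rewrite ffunE.
- by move=> x; apply: eq_bigr => j _; rewrite ffunE.
rewrite (@big_ffun_widen _ _ _ _ n.+1 N)//.
  apply/esym/big_ffunE => x; last by apply: eq_bigr => j _; rewrite ffunE.
  by rewrite /q; congr (_ == _); apply: eq_bigr => j _; rewrite ffunE.
move=> x /eqP <- j; rewrite ltnS (bigD1 j)//=; exact: leq_addr.
Qed.

(** The partial sums of the Cauchy product run over a simplex of
    multi-indices, whereas the products of partial sums run over a cube
    ([prod_series]). *)
Lemma sum_cauchy_coef (K : pzSemiRingType) (J : finType) (a : J -> nat -> K) (N : nat) :
  \sum_(0 <= n < N) cauchy_coef a n =
  \sum_(x : {ffun J -> 'I_N} | (\sum_j x j < N)%N) \prod_j a j (x j).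
Proof.
rewrite big_mkord.
under eq_bigr => n _ do rewrite (cauchy_coef_widen a (ltn_ord n)).
case: N => [|N]; first by rewrite big_ord0 big_pred0.
rewrite [RHS](partition_big
  (fun x : {ffun J -> 'I_N.+1} => inord (\sum_j x j)%N : 'I_N.+1) predT)//=.
apply: eq_bigr => n _; apply: eq_bigl => x.
apply/eqP/andP => [e|[e /eqP <-]]; last by rewrite inordK.
by rewrite e; split; [exact: ltn_ord|apply/eqP/val_inj; rewrite /= inordK].
Qed.

Lemma prod_series (K : comPzSemiRingType) (J : finType) (a : J -> nat -> K) (N : nat) :
  \prod_j \sum_(0 <= n < N) a j n =
  \sum_(x : {ffun J -> 'I_N}) \prod_j a j (x j).
Proof. by under eq_bigr => j _ do rewrite big_mkord; rewrite bigA_distr_bigA. Qed.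

Lemma cvg_divn (d : nat) : (0 < d)%N -> (n %/ d)%N @[n --> \oo] --> \oo.
Proof.
move=> d0; apply/cvgnyPge => A; exists (A * d)%N => // n /=.
by rewrite leq_divRL.
Qed.

Section CauchyProduct.
Context (K : numFieldType) (J : finType).
Implicit Types (a : J -> nat -> K).

Lemma ler_sum_sub (I : finType) (P P' : pred I) (F : I -> K) :
  (forall i, P i -> P' i) -> (forall i, 0 <= F i) ->
  \sum_(i | P i) F i <= \sum_(i | P' i) F i.
Proof.
move=> PP F0; rewrite [leLHS]big_mkcond [leRHS]big_mkcond; apply: ler_sum => i _.
by have := PP i; case: (P i) => [->//|_]; case: (P' i).
Qed.

(** The simplex of size [N] contains a cube of side about [N / #|J|]; with
    the successor [#|J|.+1] the sum of the indices stays strictly below [N],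
    for empty [J] too. *)
Lemma cube_le_simplex a (N : nat) : (0 < N)%N -> (forall j n, 0 <= a j n) ->
  \prod_j \sum_(0 <= n < N %/ #|J|.+1) a j n <= \sum_(0 <= n < N) cauchy_coef a n.
Proof.
move=> N0 a0; rewrite sum_cauchy_coef prod_series.
pose q (x : {ffun J -> nat}) := [forall j, x j < N %/ #|J|.+1]%N.
pose F (x : {ffun J -> nat}) := \prod_j a j (x j).
rewrite (big_ffunE (q := q) (F := F)); last 2 first.
- by move=> x; apply/esym/forallP => j; rewrite ffunE.
- by move=> x; apply: eq_bigr => j _; rewrite ffunE.
rewrite (@big_ffun_widen _ _ _ _ _ N); [|exact: leq_div|by move=> x /forallP].
rewrite [leRHS](big_ffunE (q := fun x => (\sum_j x j < N)%N) (F := F)); last 2 first.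
- by move=> x; under [in RHS]eq_bigr => j _ do rewrite ffunE.
- by move=> x; apply: eq_bigr => j _; rewrite ffunE.
apply: ler_sum_sub => [x /forallP qx|x]; last by apply: prodr_ge0 => j _.
have: (\sum_(j : J) [ffun j => nat_of_ord (x j)] j <= \sum_(j : J) N %/ #|J|.+1)%N.
  by apply: leq_sum => j _; exact: ltnW.
rewrite sum_nat_const => /leq_ltn_trans; apply.
have [->|k0] := posnP (N %/ #|J|.+1); first by rewrite muln0.
apply: leq_trans (leq_trunc_div N #|J|.+1).
by rewrite mulnS mulnC -addn1 addnC leq_add2r.
Qed.

(** Both sides are sums over the part of the cube outside the simplex, so the
    triangle inequality gives the bound. *)
Lemma cube_sub_simplex a (N : nat) :
  `|\prod_j \sum_(0 <= n < N) a j n - \sum_(0 <= n < N) cauchy_coef a n| <=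
  \prod_j \sum_(0 <= n < N) `|a j n| -
  \sum_(0 <= n < N) cauchy_coef (fun j n => `|a j n|) n.
Proof.
rewrite !sum_cauchy_coef !prod_series.
pose P (x : {ffun J -> 'I_N}) := (\sum_j x j < N)%N.
rewrite (bigID P)/= addrAC subrr add0r.
rewrite [in leRHS](bigID P)/= addrAC subrr add0r.
apply: le_trans (ler_norm_sum _ _ _) _.
by apply: ler_sum => x _; rewrite normr_prod.
Qed.

Lemma cvg_bigprod (u : J -> nat -> K) (s : J -> K) :
  (forall j, u j n @[n --> \oo] --> s j) ->
  \prod_j u j n @[n --> \oo] --> \prod_j s j.
Proof. by move=> us; apply: cvg_big => // x; exact: mul_continuous. Qed.

(** The error made by summing over the simplex instead of the cube is dominated
    by the same error for the absolute values, which lies between [0] and the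
    difference of two products of partial sums with the same limit. *)
Lemma cvg_cauchy_coef a (s t : J -> K) :
  (forall j, series (a j) n @[n --> \oo] --> s j) ->
  (forall j, series (fun n => `|a j n|) n @[n --> \oo] --> t j) ->
  series (cauchy_coef a) n @[n --> \oo] --> \prod_j s j.
Proof.
move=> as_ at_.
pose S N := \prod_j \sum_(0 <= n < N) a j n.
pose A N := \prod_j \sum_(0 <= n < N) `|a j n|.
have S_cvg : S n @[n --> \oo] --> \prod_j s j by exact: cvg_bigprod.
have A_cvg : A n @[n --> \oo] --> \prod_j t j by exact: cvg_bigprod.
have A'_cvg : A (n %/ #|J|.+1)%N @[n --> \oo] --> \prod_j t j.
  by apply: (cvg_comp _ A (cvg_divn (ltn0Sn #|J|))).
have D0 : S n - series (cauchy_coef a) n @[n --> \oo] --> 0.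
  apply/cvgr0Pnorm_lt => e e0.
  have /cvgr0Pnorm_lt/(_ e e0) : A n - A (n %/ #|J|.+1)%N @[n --> \oo] --> 0.
    by rewrite -(subrr (\prod_j t j)); exact: cvgB.
  move=> Ae; near=> n.
  have n0 : (0 < n)%N by near: n; exact: nbhs_infty_gt.
  have h : `|S n - series (cauchy_coef a) n| <= A n - A (n %/ #|J|.+1)%N.
    apply: le_trans (cube_sub_simplex a n) _.
    by rewrite lerB// cube_le_simplex.
  have A0 : 0 <= A n - A (n %/ #|J|.+1)%N by apply: le_trans h.
  apply: le_lt_trans h _; rewrite -(ger0_norm A0).
  by near: n.
rewrite -[X in _ --> X]subr0.
rewrite (_ : (fun n => _) = (fun n => S n - (S n - series (cauchy_coef a) n))); last first.
  by apply/funext => n; rewrite subKr.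
exact: cvgB.
Unshelve. all: by end_near. Qed.

End CauchyProduct.

(** * Complex series and the exponential *)

HB.instance Definition _ (R : realType) :=
  GRing.RMorphism.copy (@RtoC R) (real_complex R).

Section Complex.
Context (R : realType).
Implicit Types (z : Cfield R) (u : nat -> Cfield R).

Lemma RtoC_Cabs z : RtoC (Cabs z) = `|z|.
Proof. by rewrite /RtoC /Cabs [`|z|]normc_def. Qed.

Lemma RtoC_le (a b : R) : (RtoC a <= RtoC b) = (a <= b).
Proof. exact: lecR. Qed.

Lemma RtoC_lt (a b : R) : (RtoC a < RtoC b) = (a < b).
Proof. exact: ltcR. Qed.

Lemma normRtoC (a : R) : `|RtoC a| = RtoC `|a|.
Proof. by rewrite /RtoC [LHS]normc_def/= expr0n addr0 sqrtr_sqr. Qed.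

Lemma gt0_RtoC (e : Cfield R) : 0 < e -> exists2 r : R, 0 < r & e = RtoC r.
Proof.
move=> e0; have : (e : R[i]) \is Num.real by rewrite gtr0_real.
move=> /complex_realP[r er]; exists r => //.
by rewrite -RtoC_lt rmorph0 /RtoC -er.
Qed.

Lemma CabsM z z' : Cabs (z * z') = Cabs z * Cabs z'.
Proof. by apply: complexI; rewrite rmorphM /= -!/(RtoC _) !RtoC_Cabs normrM. Qed.

Lemma CabsX z n : Cabs (z ^+ n) = Cabs z ^+ n.
Proof. by apply: complexI; rewrite rmorphXn /= -!/(RtoC _) !RtoC_Cabs normrX. Qed.

Lemma CabsR (r : R) : Cabs (RtoC r) = `|r|.
Proof. by rewrite /Cabs normRtoC. Qed.

Lemma Cabs_ge0 z : 0 <= Cabs z.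
Proof. by rewrite -RtoC_le RtoC_Cabs rmorph0. Qed.

Lemma Re_le_Cabs z : `|complex.Re z| <= Cabs z.
Proof.
rewrite /Cabs [`|z|]normc_def /= -sqrtr_sqr ler_wsqrtr// lerDl; exact: sqr_ge0.
Qed.

Lemma Im_le_Cabs z : `|complex.Im z| <= Cabs z.
Proof.
rewrite /Cabs [`|z|]normc_def /= -sqrtr_sqr ler_wsqrtr// lerDr; exact: sqr_ge0.
Qed.

Lemma Cabs_le_ReIm z : Cabs z <= `|complex.Re z| + `|complex.Im z|.
Proof.
case: z => a b; rewrite /Cabs [`|_|]normc_def /=.
rewrite -[leRHS]ger0_norm ?addr_ge0// -sqrtr_sqr ler_wsqrtr// sqrrD.
by rewrite !real_normK ?num_real// -addrA lerD2l lerDr mulrn_wge0// mulr_ge0.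
Qed.

Lemma Re_series u n : complex.Re (series u n) = series (fun n => complex.Re (u n)) n.
Proof. by rewrite /series/= (raddf_sum (@complex.Re R : Rcomplex R -> R)). Qed.

Lemma Im_series u n : complex.Im (series u n) = series (fun n => complex.Im (u n)) n.
Proof. by rewrite /series/= (raddf_sum (@complex.Im R : Rcomplex R -> R)). Qed.

Lemma cvg_RtoC (f : nat -> R) a :
  f n @[n --> \oo] --> a -> RtoC (f n) @[n --> \oo] --> RtoC a.
Proof.
move=> fa; apply/cvgrPdist_lt => _/posnumP[e].
have [r r0 er] := gt0_RtoC (gt0 e).
move/cvgrPdist_lt : fa => /(_ _ r0) fa; near=> n.
rewrite er -rmorphB normRtoC RtoC_lt; near: n; exact: fa.
Unshelve. all: by end_near. Qed.

Lemma cvg_complex u (a b : R) :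
  complex.Re (u n) @[n --> \oo] --> a -> complex.Im (u n) @[n --> \oo] --> b ->
  u n @[n --> \oo] --> (a +i* b : Cfield R).
Proof.
move=> ua ub.
pose i : Cfield R := 0 +i* 1.
have e (z : Cfield R) : z = RtoC (complex.Re z) + i * RtoC (complex.Im z).
  exact: (@complexE R z).
rewrite (_ : u = fun n => RtoC (complex.Re (u n)) + i * RtoC (complex.Im (u n))).
  rewrite [X in _ --> X](e (a +i* b)).
  apply: (@cvgD _ (Cfield R)); first exact: cvg_RtoC.
  by apply: cvgMl_tmp; exact: cvg_RtoC.
by apply/funext => n; exact: e.
Qed.

Lemma Cseries_cvg u s : series u @ \oo --> s -> Cseries u = s.
Proof. exact: (cvg_lim (@norm_hausdorff _ _)). Qed.

(** The real and imaginary parts are dominated by the absolute value, so their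
    series converge by completeness of the real numbers. *)
Lemma Cabs_summable_cvg u : Cabs_summable u -> series u @ \oo --> Cseries u.
Proof.
move=> su.
have h (f : Cfield R -> R) : (forall z, `|f z| <= Cabs z) -> cvgn (series (f \o u)).
  move=> fle; apply: normed_cvg.
  by apply: series_le_cvg su => n //=; exact: Cabs_ge0.
have reu := h _ Re_le_Cabs; have imu := h _ Im_le_Cabs.
suff : series u @ \oo --> (limn (series (fun n => complex.Re (u n))) +i*
    limn (series (fun n => complex.Im (u n))) : Cfield R).
  by move=> us; rewrite (Cseries_cvg us).
by apply: cvg_complex; under eq_fun do rewrite ?Re_series ?Im_series.
Qed.

Lemma Cabs_summable_norm u : Cabs_summable u ->
  series (fun n => `|u n|) @ \oo --> RtoC (limn (series (fun n => Cabs (u n)))).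
Proof.
move=> su.
have -> : series (fun n => `|u n|) = @RtoC R \o series (fun n => Cabs (u n)).
  apply/funext => n; rewrite /= /series/= [RHS]rmorph_sum.
  by apply: eq_bigr => i _; rewrite -RtoC_Cabs.
exact: cvg_RtoC.
Qed.

Lemma Cabs_summable_cauchy_coef (J : finType) (a : J -> nat -> Cfield R) :
  (forall j, Cabs_summable (a j)) ->
  series (cauchy_coef a) @ \oo --> \prod_j Cseries (a j).
Proof.
move=> sa; apply: cvg_cauchy_coef => j; first exact: Cabs_summable_cvg.
exact: Cabs_summable_norm.
Qed.

Lemma Cabs_summable_le u (v : nat -> R) :
  (forall n, Cabs (u n) <= v n) -> cvgn (series v) -> Cabs_summable u.
Proof.
move=> uv; apply: series_le_cvg => // n; first exact: Cabs_ge0.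
exact: le_trans (Cabs_ge0 _) (uv n).
Qed.

Lemma Cabs_summableZ (c : Cfield R) u :
  Cabs_summable u -> Cabs_summable (fun n => c * u n).
Proof.
move=> su; rewrite /Cabs_summable; under eq_fun do rewrite CabsM.
by apply: is_cvg_seriesZ.
Qed.

Lemma Cexp_summable (x : Cfield R) : Cabs_summable (fun n => x ^+ n / n`!%:R).
Proof.
apply: Cabs_summable_le (is_cvg_series_exp_coeff (Cabs x)) => n.
rewrite CabsM CabsX (_ : n`!%:R^-1 = RtoC n`!%:R^-1); last first.
  by rewrite fmorphV rmorph_nat.
by rewrite CabsR ger0_norm// invr_ge0.
Qed.

(** The binomial formula, read as the Cauchy product of two exponential series;
    a multi-index over [bool] of sum [n] is determined by its value at
    [false]. *)
Lemma cauchy_coef_exp (x y : Cfield R) n :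
  cauchy_coef (fun b : bool => fun n => (if b then x else y) ^+ n / n`!%:R) n =
  (x + y) ^+ n / n`!%:R.
Proof.
rewrite /cauchy_coef.
rewrite (reindex_onto (fun i : 'I_n.+1 => [ffun b => if b then rev_ord i else i])
  (fun f : {ffun bool -> 'I_n.+1} => f false)) /=; last first.
  move=> f; rewrite big_bool => /eqP fn; apply/ffunP => -[]; rewrite ffunE//.
  by apply/val_inj; rewrite /= subSS -[X in (X - _)%N]fn addnK.
rewrite exprDn mulr_suml; apply: eq_big => [i|i _].
  by rewrite big_bool !ffunE eqxx andbT /= subSS subnK ?eqxx// -ltnS.
rewrite big_bool !ffunE /= subSS mulrnAl -mulr_natr.
have fact0 m : (m`!%:R : Cfield R) != 0 by rewrite pnatr_eq0 -lt0n fact_gt0.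
have /(congr1 (fun k => k%:R : Cfield R)) := bin_fact (ltn_ord i : (i <= n)%N).
rewrite !natrM => <-.
have bin0 : ('C(n, i)%:R : Cfield R) != 0.
  by rewrite pnatr_eq0 -lt0n bin_gt0 -ltnS.
rewrite -mulr_natr; field.
by rewrite !fact0 bin0.
Qed.

Lemma Cexp0 : Cexp (0 : Cfield R) = 1.
Proof.
apply: Cseries_cvg; rewrite -cvg_shiftS (_ : (fun n => _) = cst (1 : Cfield R)).
  exact: cvg_cst.
apply/funext => n; rewrite /series/= big_nat_recl// expr0 divr1 big1 ?addr0// => i _.
by rewrite expr0n mul0r.
Qed.

Lemma CexpD (x y : Cfield R) : Cexp (x + y) = Cexp x * Cexp y.
Proof.
apply: Cseries_cvg.
rewrite -(funext (cauchy_coef_exp x y)).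
rewrite (_ : Cexp x * _ =
    \prod_(b : bool) Cseries (fun n => (if b then x else y) ^+ n / n`!%:R)).
  apply: Cabs_summable_cauchy_coef => b; exact: Cexp_summable.
by rewrite big_bool.
Qed.

Lemma Cexp_sum (I : Type) (r : seq I) (Q : pred I) (x : I -> Cfield R) :
  Cexp (\sum_(i <- r | Q i) x i) = \prod_(i <- r | Q i) Cexp (x i).
Proof. exact: (big_morph _ CexpD Cexp0). Qed.

End Complex.

(** * Generating functions of random variables with values in the naturals *)

Section PGF.
Context (dT : measure_display) (T : measurableType dT) (R : realType)
        (P : probability T R).
Implicit Types (X : {RV P >-> nat}) (z : Cfield R).

Definition mass X (n : nat) : R := fine (P [set w | X w = n]).

Lemma measurable_RV X (A : set nat) : measurable (X @^-1` A).
Proof. by rewrite -[_ @^-1` _]setTI; apply: measurable_funPT. Qed.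

Lemma mass_ge0 X n : 0 <= mass X n.
Proof. exact: fine_ge0. Qed.

Lemma massE X n : (mass X n)%:E = P [set w | X w = n].
Proof. by rewrite fineK// fin_num_measure//; exact: (measurable_RV X [set n]). Qed.

Lemma measurable_RV_comp X (f : nat -> R) :
  measurable_fun setT (fun w => f (X w)).
Proof. by apply: (@measurableT_comp _ _ _ _ _ _ f). Qed.

(** The fibers [F n] of [X] form a countable partition on which [f \o X] is
    constant, so countable additivity of the integral gives the expectation as
    a series. *)
Section Series.
Context X (f : nat -> R).
Let F n := [set w | X w = n].

Let mF n : measurable (F n). Proof. exact: (measurable_RV X [set n]). Qed.

Let tF : trivIset setT F.
Proof.
apply/trivIsetP => i j _ _ ij; rewrite -subset0 => w [/= wi wj].
by move: ij; rewrite -wi -wj eqxx.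
Qed.

Let FT : setT = \bigcup_n F n.
Proof. by apply/seteqP; split => w //= _; exists (X w). Qed.

Let integral_fiber (g : nat -> R) n :
  (\int[P]_(w in F n) (g (X w))%:E = (mass X n * g n)%:E)%E.
Proof.
rewrite (eq_integral (cst (g n)%:E)); last by move=> w; rewrite inE => /= ->.
by rewrite integral_cst// EFinM massE muleC.
Qed.

(* The value of a series says nothing about its convergence: here the partial
   sums are bounded by the expectation. *)
Let summable_mass (g : nat -> R) : (forall n, 0 <= g n) ->
  ('E_P[fun w => g (X w)] < +oo)%E -> cvgn (series (fun n => mass X n * g n)).
Proof.
move=> g0; rewrite unlock => Efin.
have E0 : (0 <= \int[P]_w (g (X w))%:E)%E.
  by apply: integral_ge0 => w _; rewrite lee_fin.
have Ef : (\int[P]_w (g (X w))%:E)%E \is a fin_num by rewrite ge0_fin_numE.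
have s0 n : 0 <= mass X n * g n by rewrite mulr_ge0// mass_ge0.
apply: nondecreasing_is_cvgn; first exact: nondecreasing_series.
exists (fine (\int[P]_w (g (X w))%:E)%E) => _ [n _ <-].
rewrite -lee_fin fineK// {1}FT ge0_integral_bigcup//; last 2 first.
- by rewrite -FT; apply/measurable_EFinP; exact: measurable_RV_comp.
- by move=> w _; rewrite lee_fin.
rewrite /series/= -sumEFin.
rewrite (eq_eseriesr (g := fun n => (mass X n * g n)%:E)); last first.
  by move=> k _; exact: integral_fiber.
by apply: nneseries_lim_ge => k _ _; rewrite lee_fin.
Qed.

Lemma integrable_comp : ('E_P[fun w => `|f (X w)|%R] < +oo)%E ->
  P.-integrable setT (fun w => (f (X w))%:E).
Proof.
rewrite unlock => Ef; apply/integrableP; split => //.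
by apply/measurable_EFinP; exact: measurable_RV_comp.
Qed.

Lemma series_mass_cvg : ('E_P[fun w => `|f (X w)|%R] < +oo)%E ->
  series (fun n => mass X n * f n) n @[n --> \oo] --> fine 'E_P[fun w => f (X w)].
Proof.
move=> Ef; have cf : cvgn (series (fun n => mass X n * f n)).
  apply: normed_cvg; rewrite (_ : [normed _] = series (fun n => mass X n * `|f n|)).
    exact: (summable_mass (g := fun n => `|f n|)).
  apply/funext => n; apply: eq_bigr => i _.
  by rewrite /= normrM ger0_norm ?mass_ge0.
suff -> : fine 'E_P[fun w => f (X w)] = limn (series (fun n => mass X n * f n)) by [].
rewrite unlock {1}FT integral_bigcup//; last by rewrite -FT; exact: integrable_comp.
under eq_eseriesr => n _ do rewrite integral_fiber.
under eq_fun => n do rewrite sumEFin.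
by rewrite EFin_lim.
Qed.

End Series.

Lemma Cabs_integrable_cvg X z : Cabs_integrable P (fun w => z ^+ X w) ->
  Cabs_summable (fun n => RtoC (mass X n) * z ^+ n) /\
  series (fun n => RtoC (mass X n) * z ^+ n) n @[n --> \oo] -->
    Cexpectation P (fun w => z ^+ X w).
Proof.
move=> iz.
have h (f : Cfield R -> R) : (forall z', `|f z'| <= Cabs z') ->
    series (fun n => mass X n * f (z ^+ n)) n @[n --> \oo] --> fine 'E_P[fun w => f (z ^+ X w)].
  move=> fle; apply: (series_mass_cvg (f := fun n => f (z ^+ n))).
  apply: le_lt_trans iz; rewrite unlock; apply: ge0_le_integral => //=.
  - apply/measurable_EFinP; exact: (measurable_RV_comp X (fun n => `|f (z ^+ n)|)).
  - apply/measurable_EFinP; exact: (measurable_RV_comp X (fun n => Cabs (z ^+ n))).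
  - by move=> w _; rewrite lee_fin.
split.
  rewrite /Cabs_summable.
  rewrite (_ : (fun n => _) = (fun n => mass X n * Cabs (z ^+ n))).
    apply: cvgP; apply: (h (@Cabs R)) => z'.
    by rewrite ger0_norm// Cabs_ge0.
  by apply/funext => n; rewrite CabsM CabsR ger0_norm ?mass_ge0.
have mRe n : complex.Re (RtoC (mass X n) * z ^+ n) = mass X n * complex.Re (z ^+ n).
  by case: (z ^+ n) => a b /=; rewrite mul0r subr0.
have mIm n : complex.Im (RtoC (mass X n) * z ^+ n) = mass X n * complex.Im (z ^+ n).
  by case: (z ^+ n) => a b /=; rewrite mul0r addr0.
apply: cvg_complex.
- under eq_fun => n do rewrite Re_series (funext mRe).
  exact: (h (fun z => complex.Re z) (@Re_le_Cabs R)).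
- under eq_fun => n do rewrite Im_series (funext mIm).
  exact: (h (fun z => complex.Im z) (@Im_le_Cabs R)).
Qed.

Lemma expectation_abse_le1 (f : T -> R) : measurable_fun setT f ->
  (forall w, `|f w| <= 1) -> (`|'E_P[f]| <= 1)%E.
Proof.
move=> mf f1; rewrite unlock.
apply: le_trans (le_abse_integral _ _ _) _ => //; first exact/measurable_EFinP.
rewrite -(probability_setT P) -[leRHS]mul1e -integral_cst//.
apply: ge0_le_integral => //=.
- by apply/measurable_EFinP; exact: measurableT_comp.
- by move=> w _; rewrite lee_fin.
Qed.

Lemma pgf_le1 X z : `|z| <= 1 ->
  Cabs_integrable P (fun w => z ^+ X w) /\
  Cabs (Cexpectation P (fun w => z ^+ X w)) <= 2.
Proof.
move=> z1.
have zn n : Cabs (z ^+ n) <= 1.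
  by rewrite -RtoC_le RtoC_Cabs rmorph1 normrX exprn_ile1.
have h (f : Cfield R -> R) : (forall z', `|f z'| <= Cabs z') ->
    (`|'E_P[fun w => f (z ^+ X w)%R]| <= 1)%E.
  move=> fle; apply: expectation_abse_le1.
    exact: (measurable_RV_comp X (fun n => f (z ^+ n))).
  by move=> w; apply: le_trans (fle _) _.
have hfine (x : \bar R) : (`|x| <= 1)%E -> `|fine x| <= 1 by case: x.
split.
  rewrite /Cabs_integrable; apply: le_lt_trans (lee_abs _) _.
  apply: le_lt_trans (ltry 1); apply: (h (@Cabs R)) => z'.
  by rewrite ger0_norm ?Cabs_ge0.
apply: le_trans (Cabs_le_ReIm _) _; rewrite -[2]/(1 + 1).
by apply: lerD; apply: hfine; apply: h => z'; [exact: Re_le_Cabs|exact: Im_le_Cabs].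
Qed.

End PGF.

(** * The mass function of the delay *)

Section Partition.
Context (dS : measure_display) (S : measurableType dS) (R : realType)
        (Q : {measure set S -> \bar R}).

(** The exceptional null set [N] leaves room for the group sizes that do not
    add up to the number of packets, for which there are infinitely many
    possibilities. *)
Lemma measure_fin_partition (I : finType) (q : pred I) (F : I -> set S) (E N : set S) :
  measurable E -> (forall i, q i -> measurable (F i)) -> trivIset [set` q] F ->
  Q.-negligible N -> (forall i, q i -> F i `<=` E) ->
  (forall w, E w -> ~ N w -> exists2 i, q i & F i w) ->
  Q E = (\sum_(i | q i) Q (F i))%E.
Proof.
move=> mE mF tF nN FE EF.
pose U := \bigcup_(i in [set` q]) F i.
have mU : measurable U by apply: fin_bigcup_measurable => //; exact: finite_finset.
have UE : U `<=` E by move=> w [i /= qi Fw]; exact: FE qi _ Fw.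
have EU0 : Q (E `\` U) = 0%E.
  apply: measure_negligible; first exact: measurableD.
  apply: negligibleS nN => w [Ew nUw].
  apply: contra_notP nUw => /(EF _ Ew)[i qi Fw]; by exists i.
have -> : E = U `|` (E `\` U) by rewrite setDUK.
rewrite measureU//; [|exact: measurableD|by rewrite setDIK].
rewrite [X in (_ + X)%E](_ : _ = 0%E) ?adde0 /U; last exact: EU0.
rewrite measure_fin_bigcup//.
apply/esym/bigfs; first exact: index_enum_uniq.
by move=> i _; rewrite mem_index_enum.
Qed.

End Partition.

Lemma negligible_countType_bigcup (dS : measure_display) (S : measurableType dS)
  (R : realType) (Q : {measure set S -> \bar R}) (I : countType) (F : I -> set S) :
  (forall i, Q.-negligible (F i)) -> Q.-negligible (\bigcup_i F i).
Proof.
move=> nF.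
apply: (@negligibleS _ _ _ _ (\bigcup_n (if unpickle n is Some i then F i else set0))).
  by move=> w [i _ Fw]; exists (pickle i) => //; rewrite pickleK.
by apply: negligible_bigcup => n; case: unpickle => [i|]; [exact: nF|exact: negligible_set0].
Qed.

(** The mass function of [I] vanishes at each of the countably many wrong
    multi-indices. *)
Lemma multinomial_sum_negligible (dS : measure_display) (S : measurableType dS)
    (R : realType) (Q : probability S R) (d : nat) (p : 'I_d -> R) (m : nat)
    (I : 'I_d -> {RV Q >-> nat}) :
  is_multinomial p m I -> Q.-negligible [set w | (\sum_j I j w)%N != m].
Proof.
move=> hI.
apply: (@negligibleS _ _ _ _ (\bigcup_(i : {ffun 'I_d -> nat})
   (if (\sum_j i j)%N != m then [set w | forall j, I j w = i j] else set0))).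
  move=> w /= nw; exists [ffun j => I j w] => //.
  under eq_bigr do rewrite ffunE; rewrite nw /= => j; by rewrite ffunE.
apply: negligible_countType_bigcup => i; case: ifPn => [nm|_]; last exact: negligible_set0.
exists [set w | forall j, I j w = i j]; split => //.
  rewrite (_ : [set w | _] = \bigcap_(j in [set: 'I_d]) [set w | I j w = i j]).
    by apply: fin_bigcap_measurable => // j _; exact: (measurable_RV (I j) [set i j]).
  by apply/seteqP; split => [w h j _|w h j]; exact: h.
by apply: (etrans (hI i)); rewrite /multinomial_pmf (negbTE nm).
Qed.

Lemma big_ord_upto (A : Type) (idx : A) (op : Monoid.com_law idx) (d : nat)
    (k : 'I_d) (F : 'I_d -> A) :
  (forall j : 'I_d, (k < j)%N -> F j = idx) ->
  \big[op/idx]_j F j = op (\big[op/idx]_(j < d | (j < k)%N) F j) (F k).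
Proof.
move=> F0; rewrite (bigID (fun j : 'I_d => (j < k)%N))/=; congr (op _ _).
rewrite (bigD1 k)/= ?ltnn// big1 ?Monoid.mulm1// => j /andP[jk jNk].
by apply: F0; rewrite ltn_neqAle eq_sym val_eqE jNk leqNgt.
Qed.

Section Delay.
Context (dT : measure_display) (T : measurableType dT) (R : realType)
        (P : probability T R) (d : nat) (p : 'I_d -> R)
        (l t : nat -> {RV P >-> nat}).

Definition shift_seq (V : nmodType) (b : nat) (u : nat -> V) (n : nat) : V :=
  if (b <= n)%N then u (n - b)%N else 0.

(** The mass function of what the group [j], of size [i j], adds to the delay
    of a packet that joins the group [k]. The indicator that [k] is not the
    last group is counted as a shift of the summand of [k] itself; the groups
    after [k] add the constant [0]. *)
Definition cell_mass (k : 'I_d) (i : 'I_d -> nat) (j : 'I_d) : nat -> R :=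
  if (j < k)%N then mass (l (i j))
  else if j == k then shift_seq (k.+1 < d) (mass (t (i k)))
  else fun v => (v == 0)%N%:R.

(** For fixed [m] and [n] the event that the right-hand side of the equation
    for [t m] takes the value [n] splits into finitely many cases: the group sizes add up to [m] almost surely, and no summand exceeds [n]. *)
Lemma delay_mass (m : nat) (n : nat) : delay_equation p l t m ->
  mass (t m) n =
  \sum_k \sum_(i : {ffun 'I_d -> 'I_m.+1} | (\sum_j i j == m)%N)
     p k * multinomial_pmf p m (fun j => i j) * cauchy_coef (cell_mass k (fun j => i j)) n.
Proof.
move=> [dS [S [Q [g [I [X [Y [gE IE gI XE tE]]]]]]]].
pose b (k : 'I_d) : nat := (k.+1 < d)%N.
(* A case [(k, i, x)]: the group joined, the group sizes, the summands. *)
pose F (c : 'I_d * {ffun 'I_d -> 'I_m.+1} * {ffun 'I_d -> 'I_n.+1}) : set S :=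
  [set w | [/\ g w = c.1.1, forall j, I j w = c.1.2 j,
    forall j : 'I_d, (j < c.1.1)%N -> X j w = c.2 j & (b c.1.1 + Y w)%N = c.2 c.1.1]].
pose q (c : 'I_d * {ffun 'I_d -> 'I_m.+1} * {ffun 'I_d -> 'I_n.+1}) : bool :=
  [&& \sum_j c.1.2 j == m, \sum_j c.2 j == n &
      [forall (j : 'I_d | (c.1.1 < j)%N), c.2 j == 0 :> nat]]%N.
have QF c : Q (F c) = (p c.1.1 * multinomial_pmf p m (fun j => c.1.2 j) *
    (\prod_(j < d | (j < c.1.1)%N) mass (l (c.1.2 j)) (c.2 j) *
     shift_seq (b c.1.1) (mass (t (c.1.2 c.1.1))) (c.2 c.1.1)))%:E.
  case: c => [[k i] x]; rewrite /F /shift_seq /=; case: leqP => [bx|xb]; last first.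
    rewrite !mulr0 (_ : [set w | _] = set0) ?measure0//.
    rewrite -subset0 => w [_ _ _ bY].
    by move: xb; rewrite -bY ltnNge leq_addr.
  rewrite EFinM EFinM -(gE k).2 -IE -gI -XE.
  congr (Q _); apply/seteqP; split => w [gw Iw Xw Yw]; split => //.
    by rewrite -Yw addKn.
  by rewrite Yw subnKC.
(* The same case regardless of the group sizes: finitely many of these cover
   [E] exactly, which shows that [E] is measurable. *)
pose F' (c : 'I_d * {ffun 'I_d -> 'I_n.+1}) : set S :=
  [set w | [/\ g w = c.1, forall j : 'I_d, (j < c.1)%N -> X j w = c.2 j &
    (b c.1 + Y w)%N = c.2 c.1]].
pose E := [set w | ((g w).+1 < d) + \sum_(j < d | j < g w) X j w + Y w = n]%N.
have cover w : E w -> exists2 x : {ffun 'I_d -> 'I_n.+1}, F' (g w, x) w &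
    (\sum_j x j == n)%N && [forall (j : 'I_d | (g w < j)%N), x j == 0 :> nat].
  move=> Ew.
  pose v (j : 'I_d) : nat := if (j < g w)%N then X j w else
    if j == g w then (b (g w) + Y w)%N else 0%N.
  have v0 (j : 'I_d) : (g w < j)%N -> v j = 0%N.
    by move=> gj; rewrite /v ltnNge (ltnW gj)/= -val_eqE /= gtn_eqF.
  have vn : (\sum_j v j = n)%N.
    have vg : v (g w) = (b (g w) + Y w)%N by rewrite /v ltnn eqxx.
    rewrite (big_ord_upto _ v0) vg -[RHS]Ew /= addnCA addnA; congr (_ + _ + _)%N.
    by apply: eq_bigr => j; rewrite /v => ->.
  have xv j : [ffun j => inord (v j) : 'I_n.+1] j = v j :> nat.
    by rewrite ffunE inordK// ltnS -vn (bigD1 j)//= leq_addr.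
  exists [ffun j => inord (v j) : 'I_n.+1].
    split=> //=; first by move=> j jg; rewrite xv /v jg.
    by rewrite xv /v ltnn eqxx.
  rewrite (eq_bigr v) ?vn ?eqxx//=.
  by apply/forallP => j; apply/implyP => gj; rewrite xv v0.
have F'E k x w : F' (k, x) w -> (\sum_j x j == n)%N ->
    [forall (j : 'I_d | (k < j)%N), x j == 0 :> nat] -> E w.
  move=> [/= gw Xw Yw] /eqP xn /forallP x0; rewrite /E /= -[RHS]xn.
  rewrite (big_ord_upto _ (k := k)); last by move=> j kj; apply/eqP/(implyP (x0 j)).
  rewrite -Yw gw addnAC addnC; congr (_ + _)%N.
  by apply: eq_bigr => j /Xw.
have tF : trivIset [set` q] F.
  apply/trivIsetP => -[[k i] x] [[k' i'] x'] /= /and3P[_ /= _ /forallP x0].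
  move=> /and3P[_ /= _ /forallP x0'] cc'; rewrite -subset0 => w.
  move=> [[/= gw Iw Xw Yw] [/= gw' Iw' Xw' Yw']]; move: cc'.
  rewrite gw in gw'; subst k'; suff [-> ->] : i = i' /\ x = x' by rewrite eqxx.
  split; apply/ffunP => j; apply/val_inj; first by rewrite /= -Iw -Iw'.
  have [jk|kj|/val_inj ->] /= := ltngtP j k; last by rewrite -Yw -Yw'.
    by rewrite -Xw -?Xw'.
  by rewrite (eqP (implyP (x0 j) kj)) (eqP (implyP (x0' j) kj)).
have mX (Z : {RV Q >-> nat}) a : measurable [set w | Z w = a].
  exact: (measurable_RV Z [set a]).
have mF' c : measurable (F' c).
  rewrite (_ : F' c = g @^-1` [set c.1] `&`
      \bigcap_(j in [set j : 'I_d | (j < c.1)%N]) [set w | X j w = c.2 j] `&`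
      (if (b c.1 <= c.2 c.1)%N then [set w | Y w = c.2 c.1 - b c.1]%N else set0)).
    apply: measurableI; last by case: ifP => _ //; exact: mX.
    apply: measurableI; first exact: (gE _).1.
    by apply: fin_bigcap_measurable.
  apply/seteqP; split=> w.
    move=> [gw Xw Yw]; split; first by split.
    by rewrite -Yw leq_addr /= addKn.
  move=> [[gw Xw]]; case: ifP => // bx /= Yw; split=> //.
  by rewrite Yw subnKC.
have mF c : measurable (F c).
  rewrite (_ : F c = F' (c.1.1, c.2) `&`
      \bigcap_(j in [set: 'I_d]) [set w | I j w = c.1.2 j]).
    by apply: measurableI => //; apply: fin_bigcap_measurable.
  apply/seteqP; split=> w.
    by move=> [gw Iw Xw Yw]; split; [by split|move=> j _; exact: Iw].
  by move=> [[gw Xw Yw] Iw]; split=> // j; exact: Iw.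
have mE : measurable E.
  rewrite (_ : E = \bigcup_(c in [set c : 'I_d * {ffun 'I_d -> 'I_n.+1} |
      (\sum_j c.2 j == n)%N &&
      [forall (j : 'I_d | (c.1 < j)%N), c.2 j == 0 :> nat]]) F' c).
    by apply: fin_bigcup_measurable.
  apply/seteqP; split=> w; first by move=> /cover[x xF xn]; exists (g w, x).
  by move=> [[k x] /= /andP[xn x0] /F'E]; exact.
apply: EFin_inj; rewrite massE -[LHS]/(P (t m @^-1` [set n])) tE.
transitivity (Q E); first by [].
rewrite (measure_fin_partition (q := q) (F := F)
  (N := [set w | (\sum_j I j w)%N != m])) //; last 3 first.
- exact: multinomial_sum_negligible IE.
- move=> [[k i] x] /and3P[/= _ xn x0] w [/= gw _ Xw Yw].
  by apply: (F'E k x).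
- move=> w Ew; rewrite /= => /negP/negPn/eqP Im.
  have [x [_ Xw Yw] /andP[xn x0]] := cover _ Ew.
  have im j : (I j w < m.+1)%N by rewrite ltnS -Im (bigD1 j)//= leq_addr.
  exists (g w, [ffun j => inord (I j w)], x).
    apply/and3P; split => //=; rewrite -[X in _ == X]Im; apply/eqP.
    by apply: eq_bigr => j _; rewrite ffunE inordK.
  by split => //= j; rewrite ffunE inordK.
rewrite (eq_bigr _ (fun c _ => QF c)) sumEFin; congr EFin.
under [RHS]eq_bigr => k _ do under eq_bigr => i _ do rewrite mulr_sumr.
rewrite pair_big_dep pair_big_dep /=.
rewrite /q [LHS]big_mkcond [RHS]big_mkcond; apply: eq_bigr => -[[k i] x] _ /=.
case: eqP => //= _; case: eqP => //= _.
(* The right-hand side also ranges over the [x] that are not zero after [k];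
   for these a factor of the product vanishes. *)
case: ifPn => [/forallP x0|]; last first.
  rewrite negb_forall => /existsP[j]; rewrite negb_imply => /andP[kj xj].
  rewrite (bigD1 j)//= /cell_mass ltnNge (ltnW kj)/= -val_eqE /= gtn_eqF//.
  by rewrite (negbTE xj) mul0r mulr0.
congr (_ * _).
rewrite (big_ord_upto _ (k := k)) /=.
  rewrite {2}/cell_mass ltnn eqxx; congr (_ * _).
  by apply: eq_bigr => j jk; rewrite /cell_mass jk.
move=> j kj; rewrite /cell_mass ltnNge (ltnW kj)/= -val_eqE /= gtn_eqF//.
by rewrite (implyP (x0 j)).
Qed.
End Delay.

(** * The recursion for the generating functions *)

Lemma cauchy_coef_geometric (R : realType) (J : finType) (a : J -> nat -> R) (z : Cfield R) n :
  cauchy_coef (fun j v => RtoC (a j v) * z ^+ v) n = RtoC (cauchy_coef a n) * z ^+ n.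
Proof.
rewrite /cauchy_coef rmorph_sum mulr_suml; apply: eq_bigr => x /eqP xn.
by rewrite big_split/= rmorph_prod; congr (_ * _); rewrite -expr_sum xn.
Qed.

Lemma cauchy_coefZ (K : comPzRingType) (J : finType) (c : J -> K) (a : J -> nat -> K) n :
  cauchy_coef (fun j v => c j * a j v) n = (\prod_j c j) * cauchy_coef a n.
Proof. by rewrite /cauchy_coef mulr_sumr; apply: eq_bigr => x _; rewrite big_split. Qed.

Lemma series_shift_seq (V : zmodType) (b : nat) (u : nat -> V) n :
  series (shift_seq b u) (n + b)%N = series u n.
Proof.
rewrite /series/= addnC (@big_cat_nat _ _ _ b)//= ?leq_addr// big_nat big1 ?add0r.
  rewrite -{1}[b]add0n big_addn addKn; apply: eq_bigr => i _.
  by rewrite /shift_seq leq_addl addnK.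
by move=> i /andP[_ ib]; rewrite /shift_seq leqNgt ib.
Qed.

Section Cseries.
Context (R : realType).
Implicit Types (u : nat -> Cfield R).

Lemma Cabs_summable_shift_seq b u : Cabs_summable u -> Cabs_summable (shift_seq b u).
Proof.
move=> su.
suff : series (fun n => Cabs (shift_seq b u n)) n @[n --> \oo] -->
    limn (series (fun n => Cabs (u n))) by exact: cvgP.
rewrite -(cvg_shiftn b) (_ : (fun n => Cabs _) = shift_seq b (fun n => Cabs (u n))).
  by under eq_fun do rewrite series_shift_seq.
apply/funext => n; rewrite /shift_seq; case: ifP => // _.
by rewrite -(rmorph0 (@RtoC R)) CabsR normr0.
Qed.

Lemma cvg_series_shift_seq b u (s : Cfield R) :
  series u n @[n --> \oo] --> s -> series (shift_seq b u) n @[n --> \oo] --> s.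
Proof.
by move=> us; rewrite -(cvg_shiftn b); under eq_fun do rewrite series_shift_seq.
Qed.

Lemma Cseries_delta0 (x : Cfield R) :
  Cabs_summable (fun n => RtoC ((n == 0)%N%:R) * x ^+ n) /\
  Cseries (fun n => RtoC ((n == 0)%N%:R) * x ^+ n) = 1.
Proof.
have delta (V : nzRingType) n : series (fun n => (n == 0)%N%:R : V) n.+1 = 1.
  by rewrite /series/= big_nat_recl// big1 ?addr0.
have -> : (fun n => RtoC ((n == 0)%N%:R) * x ^+ n) = fun n => RtoC ((n == 0)%N%:R).
  apply/funext => -[|n]; first by rewrite expr0 mulr1.
  by rewrite rmorph0 mul0r.
split.
  suff : series (fun n => Cabs (RtoC (n == 0)%N%:R)) n @[n --> \oo] --> (1 : R).
    by exact: cvgP.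
  have -> : (fun n => Cabs (RtoC (n == 0)%N%:R : Cfield R)) = fun n => (n == 0)%N%:R.
    by apply/funext => n; rewrite CabsR normr_nat.
  rewrite -cvg_shiftS (_ : (fun n => _) = cst (1 : R)); first exact: cvg_cst.
  by apply/funext => n; exact: delta.
apply: Cseries_cvg; rewrite -cvg_shiftS (_ : (fun n => _) = cst (1 : Cfield R)).
  exact: cvg_cst.
apply/funext => n; rewrite -[RHS](delta _ n) /series/=.
by apply: eq_bigr => i _; rewrite rmorph_nat.
Qed.

End Cseries.

Section DelayPgf.
Context (dT : measure_display) (T : measurableType dT) (R : realType)
        (P : probability T R) (d : nat) (p : 'I_d -> R)
        (l t : nat -> {RV P >-> nat}).

(** The generating function of the contribution of the group [j] of size [n]
    to the delay of a packet that joins the group [k], without the shift that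
    [cell_mass] attaches to the group [k]. *)
Definition cell_pgf (z : Cfield R) (k j : 'I_d) (n : nat) : Cfield R :=
  if (j < k)%N then pgf l n z else if j == k then pgf t n z else 1.

Lemma cell_mass_series (z : Cfield R) (k j : 'I_d) (i : 'I_d -> nat) :
  pgf_converges l z -> pgf_converges t z ->
  let a n := RtoC (cell_mass l t k i j n) * z ^+ n in
  Cabs_summable a /\
  Cseries a = (if j == k then z ^+ (k.+1 < d) else 1) * cell_pgf z k j (i j).
Proof.
move=> lz tz; rewrite /cell_mass /cell_pgf; case: ifPn => [jk|jk].
  have -> : (j == k) = false by rewrite -val_eqE /= ltn_eqF.
  have [? h] := Cabs_integrable_cvg (lz (i j)).
  by split=> //; rewrite mul1r; exact: Cseries_cvg.
case: eqVneq => [->|_]; last first.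
  rewrite mulr1; exact: Cseries_delta0.
set b : nat := (k.+1 < d)%N.
have [s h] := Cabs_integrable_cvg (tz (i k)).
have e : (fun n => RtoC (shift_seq b (mass (t (i k))) n) * z ^+ n) =
    shift_seq b (fun n => z ^+ b * (RtoC (mass (t (i k)) n) * z ^+ n)).
  apply/funext => n; rewrite /shift_seq; case: ifPn => [bn|_]; last by rewrite rmorph0 mul0r.
  by rewrite mulrCA -exprD subnKC.
split; first by rewrite e; apply: Cabs_summable_shift_seq; exact: Cabs_summableZ.
rewrite e; apply: Cseries_cvg; apply: cvg_series_shift_seq.
under eq_fun => n do rewrite /series/= -mulr_sumr.
by apply: cvgMl_tmp.
Qed.

(** The decomposition of the mass function, summed against [z ^+ n]; for each
    group joined and all group sizes this is a Cauchy product of generating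
    functions. *)
Lemma pgf_delay (z : Cfield R) (m : nat) :
  delay_equation p l t m -> pgf_converges l z -> pgf_converges t z ->
  pgf t m z =
  \sum_k \sum_(i : {ffun 'I_d -> 'I_m.+1} | (\sum_j i j == m)%N)
     RtoC (p k * multinomial_pmf p m (fun j => i j)) *
     (z ^+ (k.+1 < d) * \prod_j cell_pgf z k j (i j)).
Proof.
move=> tE lz tz.
have [_ h] := Cabs_integrable_cvg (tz m).
apply: (cvg_unique (@norm_hausdorff _ (Cfield R)) h).
pose a (k : 'I_d) (i : {ffun 'I_d -> 'I_m.+1}) j n :=
  RtoC (cell_mass l t k (fun j => i j) j n) * z ^+ n.
rewrite (_ : series _ = fun N => \sum_k \sum_(i : {ffun 'I_d -> 'I_m.+1} | (\sum_j i j == m)%N)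
     RtoC (p k * multinomial_pmf p m (fun j => i j)) * series (cauchy_coef (a k i)) N); last first.
  apply/funext => N; rewrite /series/=.
  under [RHS]eq_bigr => k _ do under eq_bigr => i _ do rewrite mulr_sumr.
  under [RHS]eq_bigr => k _ do rewrite exchange_big.
  rewrite [RHS]exchange_big; apply: eq_bigr => n _.
  rewrite (delay_mass n tE) rmorph_sum mulr_suml; apply: eq_bigr => k _.
  rewrite rmorph_sum mulr_suml; apply: eq_bigr => i _.
  by rewrite /a cauchy_coef_geometric rmorphM /= mulrA.
apply: cvg_big => [|k _]; first exact: add_continuous.
apply: cvg_big => [|i _]; first exact: add_continuous.
apply: cvgMl_tmp.
have -> : z ^+ (k.+1 < d) * \prod_j cell_pgf z k j (i j) = \prod_j Cseries (a k i j).
  transitivity (\prod_j ((if j == k then z ^+ (k.+1 < d) else 1) * cell_pgf z k j (i j))).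
    rewrite big_split/=; congr (_ * _).
    by rewrite (bigD1 k)//= eqxx big1 ?mulr1// => j /negbTE ->.
  apply: eq_bigr => j _; apply/esym.
  exact: (cell_mass_series k j (fun j => i j) lz tz).2.
apply: Cabs_summable_cauchy_coef => j.
exact: (cell_mass_series k j (fun j => i j) lz tz).1.
Qed.

End DelayPgf.

(** * The functional equation *)

Lemma Cabs_summable_bounded (R : realType) (c u : nat -> Cfield R) (B : R) :
  (forall n, Cabs (c n) <= B) -> Cabs_summable u ->
  Cabs_summable (fun n => c n * u n).
Proof.
move=> cB su; apply: (@Cabs_summable_le _ _ (fun n => B * Cabs (u n))).
  by move=> n; rewrite CabsM ler_wpM2r// Cabs_ge0.
exact: is_cvg_seriesZ.
Qed.

Section FunctionalEquation.
Context (dT : measure_display) (T : measurableType dT) (R : realType)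
        (P : probability T R) (d : nat) (p : 'I_d -> R)
        (l t : nat -> {RV P >-> nat}).

Lemma Cexpectation_as1 (X : {RV P >-> nat}) (z : Cfield R) :
  P (X @^-1` [set 1%N]) = 1%E -> Cabs_integrable P (fun w => z ^+ X w) ->
  Cexpectation P (fun w => z ^+ X w) = z.
Proof.
move=> X1 /Cabs_integrable_cvg[_ h].
have massX n : mass X n = (n == 1)%N%:R.
  apply: EFin_inj; rewrite massE; case: eqVneq => [->|n1]; first exact: X1.
  apply/eqP; rewrite -measure_le0.
  rewrite [leRHS](_ : _ = P (~` (X @^-1` [set 1%N]))).
    apply: le_measure; rewrite ?inE; [exact: (measurable_RV X [set n])| |].
      by apply: measurableC; exact: measurable_RV.
    by move=> w /= -> ; exact/eqP.
  by rewrite probability_setC ?X1 ?subee//; exact: measurable_RV.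
suff hz : series (fun n => RtoC (mass X n) * z ^+ n) n @[n --> \oo] --> z.
  exact: (cvg_unique (@norm_hausdorff _ (Cfield R)) h hz).
rewrite -(cvg_shiftn 2) (_ : (fun n => _) = cst z); first exact: cvg_cst.
apply/funext => n; rewrite /series/= addn2 !big_nat_recl//= !massX /= rmorph0 mul0r add0r.
rewrite rmorph1 expr1 mul1r big1 ?addr0// => i _.
by rewrite massX /= rmorph0 mul0r.
Qed.

Context (x z : Cfield R).

(** The [n]-th term of the Poisson transform, at [p j * x], of the generating
    functions [cell_pgf z k j]. Giving each group its share
    [Cexp (- (p j * x))] of [Cexp (- x)] makes the terms of [Gfun] and [Qfun]
    appear, and makes the sum equal to [1] for the groups after [k]. *)
Definition cell_term (k j : 'I_d) (n : nat) : Cfield R :=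
  Cexp (- (RtoC (p j) * x)) *
  ((RtoC (p j) * x) ^+ n / n`!%:R * cell_pgf l t z k j n).

Lemma cell_term_series (k j : 'I_d) : converges_at p l t x z ->
  Cabs_summable (cell_term k j) /\
  Cseries (cell_term k j) =
    if (j < k)%N then Qfun l (RtoC (p j) * x) z
    else if j == k then Gfun t (RtoC (p k) * x) z else 1.
Proof.
move=> [lz tz _ sG sQ]; rewrite /cell_term /cell_pgf.
have CZ c (u : nat -> Cfield R) : Cabs_summable u ->
    Cabs_summable (fun n => c * u n) /\ Cseries (fun n => c * u n) = c * Cseries u.
  move=> su; split; first exact: Cabs_summableZ.
  apply: Cseries_cvg.
  rewrite (_ : series _ = fun n => c * series u n); last first.
    by apply/funext => n; rewrite /series/= mulr_sumr.
  by apply: cvgMl_tmp; exact: Cabs_summable_cvg.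
case: ifPn => [jk|_]; first by have := CZ (Cexp (- (RtoC (p j) * x))) _ (sQ k j jk).
case: eqVneq => [->|_].
  rewrite (_ : (fun n => _) = Gterm t (RtoC (p k) * x) z).
    by split=> //; exact: sG.
  by apply/funext => n; rewrite /Gterm [RHS]mulrAC [RHS]mulrC [X in _ * X]mulrC.
under eq_fun do rewrite mulr1.
have [? ->] := CZ (Cexp (- (RtoC (p j) * x))) _ (@Cexp_summable _ (RtoC (p j) * x)).
by split=> //; rewrite -CexpD addNr Cexp0.
Qed.

(** The factorials and powers in the terms of the exponential series recombine
    into the multinomial probabilities. *)
Lemma cauchy_coef_cell_term (k : 'I_d) (m : nat) : \sum_j p j = 1 ->
  cauchy_coef (cell_term k) m = Cexp (- x) * (x ^+ m / m`!%:R) *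
    \sum_(i : {ffun 'I_d -> 'I_m.+1} | (\sum_j i j == m)%N)
      RtoC (multinomial_pmf p m (fun j => i j)) * \prod_j cell_pgf l t z k j (i j).
Proof.
move=> p1; rewrite /cell_term cauchy_coefZ -Cexp_sum.
have -> : \sum_j - (RtoC (p j) * x) = - x.
  by rewrite sumrN -mulr_suml -rmorph_sum /= p1 rmorph1 mul1r.
rewrite -mulrA; congr (_ * _); rewrite /cauchy_coef mulr_sumr; apply: eq_bigr => i im.
rewrite big_split/= mulrA; congr (_ * _).
rewrite /multinomial_pmf im !rmorphM /= fmorphV !rmorph_prod rmorph_nat.
have -> : \prod_j ((RtoC (p j) * x) ^+ i j / (i j)`!%:R) =
    x ^+ m * (\prod_j RtoC (p j) ^+ i j) * (\prod_j (i j)`!%:R)^-1.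
  rewrite big_split/= prodfV; congr (_ * _).
  under eq_bigr do rewrite exprMn.
  by rewrite big_split/= mulrC -expr_sum (eqP im).
rewrite (eq_bigr (fun j => RtoC (p j) ^+ i j)); last by move=> j _; rewrite rmorphXn.
rewrite [X in _ = _ * (_ / X * _)](eq_bigr (fun j => (i j)`!%:R)); last first.
  by move=> j _; rewrite rmorph_nat.
have m0 : (m`!%:R : Cfield R) != 0 by rewrite pnatr_eq0 -lt0n fact_gt0.
have i0 : (\prod_j (i j)`!%:R : Cfield R) != 0.
  by apply/prodf_neq0 => j _; rewrite pnatr_eq0 -lt0n fact_gt0.
by field; rewrite i0 m0.
Qed.

(** For [m = 0] the Cauchy coefficient is [Cexp (- x) * z ^+ k.+1], so the
    second summand alone would be [Cexp (- x) * z ^+ (k.+1 + (k.+1 < d))]; the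
    first one corrects it to [Cexp (- x) * z], the value on the left. *)
Lemma Gterm_split (m : nat) : \sum_j p j = 1 ->
  is_cri_length p l -> is_tagged_delay p l t ->
  pgf_converges l z -> pgf_converges t z ->
  Gterm t x z m = \sum_k RtoC (p k) *
    (Cexp (- x) * (z - z ^+ (k.+1 + (k.+1 < d))) * (m == 0)%N%:R +
     z ^+ (k.+1 < d) * cauchy_coef (cell_term k) m).
Proof.
move=> p1 [l0 _ _] [t0 tE] lz tz.
have pS : \sum_j RtoC (p j) = 1 by rewrite -rmorph_sum p1 rmorph1.
case: m => [|m].
  rewrite /Gterm expr0 fact0 divr1 mulr1 /pgf (Cexpectation_as1 t0 (tz 0%N)).
  rewrite -[LHS]mul1r -{1}pS mulr_suml; apply: eq_bigr => k _; congr (_ * _).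
  rewrite cauchy_coef_cell_term// expr0 fact0 divr1 !mulr1.
  pose i0 : {ffun 'I_d -> 'I_1} := [ffun=> ord0].
  rewrite (big_pred1 i0); last first.
    move=> i; rewrite /= (_ : i = i0); last first.
      by apply/ffunP => j; rewrite ord1 [RHS]ord1.
    by rewrite eqxx; apply/eqP; rewrite big1// => j _; rewrite ffunE.
  have -> : multinomial_pmf p 0 (fun j => i0 j) = 1.
    have -> : (fun j => i0 j : nat) = fun=> 0%N by apply/funext => j; rewrite ffunE.
    by rewrite /multinomial_pmf !big1// eqxx fact0 divr1 mulr1.
  rewrite rmorph1 mul1r (big_ord_upto _ (k := k)).
    rewrite /cell_pgf ltnn eqxx ffunE /pgf (Cexpectation_as1 t0 (tz 0%N)).
    rewrite (eq_bigr (fun=> z)) => [|j jk]; last first.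
      by rewrite jk ffunE (Cexpectation_as1 l0 (lz 0%N)).
    rewrite prodr_const.
    have -> : #|[pred j : 'I_d | (j < k)%N]| = k.
      rewrite -sum1_card -(big_ord_widen d (fun=> 1%N)) ?sum1_card ?card_ord//.
      exact: ltnW.
    by rewrite addnC exprD exprS /=; ring.
  by move=> j kj; rewrite /cell_pgf ltnNge (ltnW kj) /= -val_eqE /= gtn_eqF.
rewrite /Gterm (pgf_delay (tE m.+1 isT) lz tz) /= mulr_suml mulr_suml.
apply: eq_bigr => k _; rewrite mulr0 add0r cauchy_coef_cell_term//.
rewrite !mulr_suml !mulr_sumr; apply: eq_bigr => i _.
rewrite rmorphM /=; ring.
Qed.

Lemma Gfun_equation : \sum_j p j = 1 ->
  is_cri_length p l -> is_tagged_delay p l t -> converges_at p l t x z ->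
  Gfun t x z =
     \sum_(k < d) RtoC (p k) *
       (Cexp (- x) * (z - z ^+ (k.+1 + (k.+1 < d))) +
        z ^+ (k.+1 < d) * Gfun t (RtoC (p k) * x) z *
        \prod_(i < d | (i < k)%N) Qfun l (RtoC (p i) * x) z).
Proof.
move=> p1 hl ht cv; have [lz tz _ _ _] := cv.
apply: Cseries_cvg.
rewrite (funext (fun m => Gterm_split m p1 hl ht lz tz)).
rewrite (_ : series _ = fun N => \sum_k RtoC (p k) *
    (Cexp (- x) * (z - z ^+ (k.+1 + (k.+1 < d))) * series (fun m => (m == 0)%N%:R) N +
     z ^+ (k.+1 < d) * series (cauchy_coef (cell_term k)) N)); last first.
  apply/funext => N; rewrite /series/= exchange_big; apply: eq_bigr => k _.
  by rewrite -mulr_sumr big_split/= -!mulr_sumr.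
apply: cvg_big => [|k _]; first exact: add_continuous.
apply: cvgMl_tmp; apply: (@cvgD _ (Cfield R)).
  rewrite -[X in _ --> X]mulr1; apply: cvgMl_tmp.
  rewrite -cvg_shiftS (_ : (fun n => _) = cst (1 : Cfield R)); first exact: cvg_cst.
  by apply/funext => n; rewrite /series/= big_nat_recl// big1 ?addr0.
rewrite -mulrA; apply: cvgMl_tmp.
rewrite (_ : _ * _ = \prod_j Cseries (cell_term k j)).
  by apply: Cabs_summable_cauchy_coef => j; exact: (cell_term_series k j cv).1.
rewrite (eq_bigr _ (fun j _ => (cell_term_series k j cv).2)) (big_ord_upto _ (k := k)).
  rewrite ltnn eqxx mulrC; congr (_ * _); by apply: eq_bigr => j ->.
by move=> j kj; rewrite ltnNge (ltnW kj) /= -val_eqE /= gtn_eqF.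
Qed.

Lemma converges_at_le1 : `|z| <= 1 -> converges_at p l t x z.
Proof.
move=> z1.
have sG y : Cabs_summable (Gterm t y z).
  apply: (Cabs_summable_bounded (B := 2 * Cabs (Cexp (- y)))) (@Cexp_summable _ y) => n.
  by rewrite CabsM ler_wpM2r ?Cabs_ge0 ?(pgf_le1 _ z1).2.
split=> //.
- by move=> n; exact: (pgf_le1 _ z1).1.
- by move=> n; exact: (pgf_le1 _ z1).1.
- move=> k i ik; rewrite /Qterm /Cabs_summable; under eq_fun do rewrite mulrC.
  apply: (Cabs_summable_bounded (B := 2)) (@Cexp_summable _ _) => n.
  exact: (pgf_le1 _ z1).2.
Qed.

End FunctionalEquation.

Theorem proposition4 (R : realType) (d : nat) (p : 'I_d -> R)
    (dT : measure_display) (T : measurableType dT) (P : probability T R)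
    (l t : nat -> {RV P >-> nat}) :
  (2 <= d)%N ->
  (forall j, 0 <= p j) ->
  \sum_j p j = 1 ->
  (forall j, p j != 1) ->
  is_cri_length p l ->
  is_tagged_delay p l t ->
  (forall x z : Cfield R, converges_at p l t x z ->
     Gfun t x z =
     \sum_(k < d) RtoC (p k) *
       (Cexp (- x) * (z - z ^+ (k.+1 + (k.+1 < d))) +
        z ^+ (k.+1 < d) * Gfun t (RtoC (p k) * x) z *
        \prod_(i < d | (i < k)%N) Qfun l (RtoC (p i) * x) z))
  /\
  (forall x z : Cfield R, `|z| <= 1 -> converges_at p l t x z).
Proof.
move=> _ _ p1 _ hl ht; split=> [x z|x z]; first exact: Gfun_equation.
exact: converges_at_le1.
Qed.
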